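(* Let $(\mathcal{A}=\bigoplus_{g\in\mathbb{Z}}\mathcal{A}_g,\star,Q_B)$ be the string field algebra with $\star$-identity $\mathcal{I}\in\mathcal{A}_0$, let $\Psi_0\in\mathcal{A}_1$ be a solution of the equation of motion $Q_B\Psi_0+\Psi_0\star\Psi_0=0$ (the tachyon vacuum), and let $Q_{\Psi_0}$ be the BRST operator around $\Psi_0$. Then the entire cohomology of $Q_{\Psi_0}$ is trivial (that is, for every ghost number $g\in\mathbb{Z}$, every $\Phi\in\mathcal{A}_g$ with $Q_{\Psi_0}\Phi=0$ is of the form $\Phi=Q_{\Psi_0}\chi$ for some $\chi\in\mathcal{A}_{g-1}$) if and only if the identity is $Q_{\Psi_0}$-exact, i.e. there exists $A\in\mathcal{A}_{-1}$ such that $$Q_{\Psi_0}A=Q_BA+\Psi_0\star A+A\star\Psi_0=\mathcal{I}.$$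
   Context: The string field algebra is treated algebraically (ignoring possible anomalies): $\mathcal{A}=\bigoplus_{g\in\mathbb{Z}}\mathcal{A}_g$ is a complex vector space graded by ghost number $g$, with an associative bilinear product $\star$ satisfying $\mathcal{A}_g\star\mathcal{A}_h\subseteq\mathcal{A}_{g+h}$ and having a two-sided identity $\mathcal{I}\in\mathcal{A}_0$, i.e. $\mathcal{I}\star\psi=\psi\star\mathcal{I}=\psi$ for all $\psi$. The operator $Q_B:\mathcal{A}_g\to\mathcal{A}_{g+1}$ is linear, satisfies $Q_B^2=0$, and is a graded derivation: $Q_B(\phi\star\psi)=(Q_B\phi)\star\psi+(-1)^{g}\phi\star(Q_B\psi)$ for $\phi\in\mathcal{A}_g$. For $\Psi\in\mathcal{A}_1$ with $Q_B\Psi+\Psi\star\Psi=0$, the BRST operator around $\Psi$ is $$Q_{\Psi}\Phi=Q_B\Phi+\Psi\star\Phi-(-1)^{g}\,\Phi\star\Psi\qquad(\Phi\in\mathcal{A}_g).$$ It maps $\mathcal{A}_g$ to $\mathcal{A}_{g+1}$. *)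

(* Defs.v *)
From mathcomp Require Import all_boot all_order all_algebra.
From mathcomp Require Import complex reals.

Set Implicit Arguments.
Unset Strict Implicit.
Unset Printing Implicit Defensive.

Import Order.TTheory GRing.Theory Num.Theory.
Local Open Scope ring_scope.
Local Open Scope complex_scope.

(* The product is not taken from an [algType], since that structure imposes
   1 != 0, which is not assumed here. *)
Record stringFieldAlgebra (R : realType) := StringFieldAlgebra {
  sfaCarrier :> lmodType R[i];
  ghost : int -> submodClosed sfaCarrier;
  star : {bilinear sfaCarrier -> sfaCarrier -> sfaCarrier};
  starI : sfaCarrier;
  QB : {linear sfaCarrier -> sfaCarrier};
  (* [ghost_span] and [ghost_free]: the carrier is the internal direct sum of
     the subspaces [ghost g]. *)
  ghost_span : forall x : sfaCarrier,
    exists (s : seq int) (f : int -> sfaCarrier),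
      (forall g, f g \in ghost g) /\ x = \sum_(g <- s) f g;
  ghost_free : forall (s : seq int) (f : int -> sfaCarrier),
    uniq s -> (forall g, f g \in ghost g) -> \sum_(g <- s) f g = 0 ->
    forall g, g \in s -> f g = 0;
  star_ghost : forall (g h : int) (x y : sfaCarrier),
    x \in ghost g -> y \in ghost h -> star x y \in ghost (g + h);
  starA : associative star;
  starI_ghost : starI \in ghost 0;
  star1x : left_id starI star;
  starx1 : right_id starI star;
  QB_ghost : forall (g : int) (x : sfaCarrier),
    x \in ghost g -> QB x \in ghost (g + 1);
  QB_square : forall x : sfaCarrier, QB (QB x) = 0;
  QB_derivation : forall (g : int) (x y : sfaCarrier), x \in ghost g ->
    QB (star x y) = star (QB x) y + ((-1 : R[i]) ^ g) *: star x (QB y)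
}.

Arguments ghost {R} _ _.
Arguments starI {R} _.

Definition eom (R : realType) (A : stringFieldAlgebra R)
    (Psi : A) : Prop := QB A Psi + star A Psi Psi = 0.

(* Depends on the degree [g] through the sign; only meaningful for
   [Phi \in ghost A g]. *)
Definition brst (R : realType) (A : stringFieldAlgebra R)
    (Psi : A) (g : int) (Phi : A) : A :=
  QB A Phi + star A Psi Phi - ((-1 : R[i]) ^ g) *: star A Phi Psi.

Definition trivial_cohomology (R : realType) (A : stringFieldAlgebra R)
    (Psi : A) : Prop :=
  forall (g : int) (Phi : A), Phi \in ghost A g -> brst Psi g Phi = 0 ->
  exists2 chi : A, chi \in ghost A (g - 1) & Phi = brst Psi (g - 1) chi.

(* Main.v *)
Require Import Defs.
From mathcomp Require Import all_boot all_order all_algebra.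
From mathcomp Require Import complex reals.

Import Order.TTheory GRing.Theory Num.Theory.
Local Open Scope ring_scope.

(** The identity is always Q-closed, so trivial cohomology makes it exact.
    Conversely, if QA = I then left multiplication by A is a contracting
    homotopy: Q(A * Phi) = (QA) * Phi - A * (Q Phi) = Phi for closed Phi. *)

Lemma exprz_N1_pred (F : fieldType) (g : int) :
  (-1 : F) ^ (g - 1) = - (-1) ^ g.
Proof. by rewrite expfzDr ?oppr_eq0 ?oner_eq0 // exprN1 invrN1 mulrN1. Qed.

Section Brst.
Variables (R : realType) (A : stringFieldAlgebra R).
Implicit Types (Psi a Phi : A) (g : int).

(** By the derivation rule applied to I * I = I, [QB] of the identity equals twice itself. *)
Lemma QB_starI : QB A (starI A) = 0.
Proof.
have := QB_derivation (starI A) (starI_ghost A).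
rewrite expr0z scale1r !star1x starx1.
by move/(canLR (addrK _)); rewrite subrr.
Qed.

Lemma brst_starI Psi : brst Psi 0 (starI A) = 0.
Proof. by rewrite /brst QB_starI expr0z scale1r star1x starx1 add0r subrr. Qed.

(** In odd degree the graded commutator with [Psi] is an anticommutator. *)
Lemma brst_N1 Psi a :
  brst Psi (-1) a = QB A a + star A Psi a + star A a Psi.
Proof. by rewrite /brst exprN1 invrN1 scaleN1r opprK. Qed.

(* The mixed terms a * Psi * Phi from the two summands cancel. *)
Lemma brst_star_N1 Psi a g Phi : a \in ghost A (-1) ->
  brst Psi (g - 1) (star A a Phi) =
  star A (brst Psi (-1) a) Phi - star A a (brst Psi g Phi).
Proof.
move=> ha; rewrite brst_N1 /brst (QB_derivation _ ha) exprz_N1_pred.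
rewrite exprN1 invrN1 scaleN1r scaleNr opprK !linearDl.
rewrite (linearB (star A a)) (linearD (star A a)) linearZ /=.
(* Both sides end in (-1)^g a * Phi * Psi, which [congr] splits off. *)
rewrite !starA !opprD opprK !addrA; congr (_ + _).
by rewrite [RHS](addrAC _ _ (- star A (star A a Psi) Phi)) addrK addrAC.
Qed.

End Brst.

Theorem mainTheorem1 (R : realType) (A : stringFieldAlgebra R) (Psi0 : A)
    (hPsi0 : Psi0 \in ghost A 1) (hEOM : eom Psi0) :
  trivial_cohomology Psi0 <->
  exists a : A,
    [/\ a \in ghost A (-1),
        brst Psi0 (-1) a = QB A a + star A Psi0 a + star A a Psi0
      & QB A a + star A Psi0 a + star A a Psi0 = starI A].
Proof.
split=> [triv | [a [ha Qa QaI]] g Phi hPhi closed_Phi].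
  have [a] := triv 0 _ (starI_ghost A) (brst_starI R A Psi0).
  rewrite sub0r => ha Ia.
  by exists a; split; rewrite // -?brst_N1.
(* [addrC] turns the degree [g - 1] into [-1 + g], the sum of the degrees of [a] and [Phi]. *)
exists (star A a Phi); first by rewrite addrC; exact: star_ghost.
by rewrite brst_star_N1 // closed_Phi linear0 subr0 Qa QaI star1x.
Qed.
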